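(* Let $\alpha\in(0,1)$, $T>0$, $N\ge1$ an integer, $\Delta t=T/N$, $t_k=k\Delta t$. For any function $u\in C([0,T];L^2(\Omega))$, with $u^k=u(t_k)$, and for every $1\le n\le N$, $$\sum_{k=1}^n\left\langle L_k^\alpha u,\,3D_ku-D_{k-1}u\right\rangle\ \ge\ \frac{\alpha\,\Delta t^{1-\alpha}}{2\,\Gamma(3-\alpha)}\sum_{k=1}^n\|D_ku\|^2\ \ge\ 0,$$ where $D_ku=\dfrac{u^k-u^{k-1}}{\Delta t}$ for $k\ge1$ and $D_0u=0$.
   Context: $\Omega$ is a bounded domain (a periodic box in the paper); $\langle\cdot,\cdot\rangle$ and $\|\cdot\|$ are the $L^2(\Omega)$ inner product and norm. The L2 operator: for a sequence $(u^k)$, $$L_1^\alpha u=\frac{1}{\Gamma(2-\alpha)\Delta t^\alpha}(u^1-u^0),$$ and for $k\ge2$, $$L_k^\alpha u=\frac{1}{\Gamma(3-\alpha)\Delta t^\alpha}\Big\{\sum_{j=1}^{k-1}\big(a_ju^{k-j-1}+b_ju^{k-j}+c_ju^{k-j+1}\big)+\frac\alpha2u^{k-2}-2u^{k-1}+\frac{4-\alpha}{2}u^k\Big\},$$ where $a_j=-\frac32(2-\alpha)(j+1)^{1-\alpha}+\frac12(2-\alpha)j^{1-\alpha}+(j+1)^{2-\alpha}-j^{2-\alpha}$, $b_j=2(2-\alpha)(j+1)^{1-\alpha}-2(j+1)^{2-\alpha}+2j^{2-\alpha}$, $c_j=-\frac12(2-\alpha)\big((j+1)^{1-\alpha}+j^{1-\alpha}\big)+(j+1)^{2-\alpha}-j^{2-\alpha}$.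 Equivalently, with $d_1=c_1+2-2\alpha$ and $d_j=c_j-a_{j-1}$ for $j\ge2$, one has for $k\ge2$ $$L_k^\alpha u=\frac{\Delta t^{1-\alpha}}{\Gamma(3-\alpha)}\Big\{\frac{3\alpha}{2}D_ku-\frac\alpha2D_{k-1}u+\sum_{j=1}^kd_jD_{k-j+1}u-c_kD_1u\Big\},$$ and $L_1^\alpha u=\frac{\Delta t^{1-\alpha}}{\Gamma(3-\alpha)}(2-\alpha)D_1u$. *)

(* Defs.v *)
From HB Require Import structures.
From mathcomp Require Import all_boot all_order all_algebra.
From mathcomp Require Import all_classical all_reals all_analysis measurable_realfun.
Set Implicit Arguments.
Unset Strict Implicit.
Unset Printing Implicit Defensive.
Import Order.TTheory GRing.Theory Num.Theory numFieldNormedType.Exports.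
Local Open Scope classical_set_scope.
Local Open Scope ring_scope.

Section lebesgue_tuple.
Context (R : realType).
Local Notation RR := (measurableTypeR R).

Definition cons_tuple n (p : RR * n.-tuple RR) : n.+1.-tuple RR :=
  [tuple of p.1 :: p.2].

Lemma measurable_cons_tuple n : measurable_fun setT (@cons_tuple n).
Proof. exact: measurable_cons. Qed.

Section step.
Variables (n : nat) (mu : {sigma_finite_measure set (n.-tuple RR) -> \bar R}).

Definition lebesgue_cons : set (n.+1.-tuple RR) -> \bar R :=
  pushforward (@lebesgue_measure R \x mu)%E (@cons_tuple n).

HB.instance Definition _ := Measure.copy lebesgue_cons
  (measure_function_pushforward__canonical__measure_function_Measure
     (@lebesgue_measure R \x mu)%E (@measurable_cons_tuple n)).

Let uncons (t : n.+1.-tuple RR) : RR * n.-tuple RR :=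
  (thead t, [tuple of behead t]).

Let measurable_uncons : measurable_fun setT uncons.
Proof.
by apply: measurable_fun_pair; [exact: measurable_tnth|exact: measurable_behead].
Qed.

Let cons_tupleK : cancel (@cons_tuple n) uncons.
Proof.
by move=> [x t]; rewrite /uncons theadE; congr pair; exact/val_inj.
Qed.

Let lebesgue_cons_sigma_finite : sigma_finite setT lebesgue_cons.
Proof.
have /sigma_finiteP[F [FT ndF Foo]] := sigma_finiteT (@lebesgue_measure R).
have /sigma_finiteP[G [GT ndG Goo]] := sigma_finiteT mu.
exists (fun k => uncons @^-1` (F k `*` G k)).
  rewrite -preimage_bigcup -[LHS](preimage_setT uncons); congr preimage.
  apply/esym/seteqP; split=> // -[x y] _.
  have [k _ Fx] : (\bigcup_i F i) x by rewrite -FT.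
  have [l _ Gy] : (\bigcup_i G i) y by rewrite -GT.
  exists (maxn k l) => //; split.
    by move: x Fx; exact/subsetPset/ndF/leq_maxl.
  by move: y Gy; exact/subsetPset/ndG/leq_maxr.
move=> k; have [mFk Fk] := Foo k; have [mGk Gk] := Goo k; split.
  rewrite -[X in measurable X]setTI; apply: measurable_uncons => //.
  exact: measurableX.
rewrite /lebesgue_cons /pushforward -comp_preimage.
rewrite (_ : uncons \o _ = id) ?preimage_id; last exact/funext.
rewrite product_measure1E// lte_mul_pinfty// ge0_fin_numE//.
Qed.

HB.instance Definition _ :=
  Measure_isSigmaFinite.Build _ _ _ lebesgue_cons lebesgue_cons_sigma_finite.

End step.

Fixpoint lebesgue_tuple n : {sigma_finite_measure set (n.-tuple RR) -> \bar R} :=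
  if n is m.+1 then lebesgue_cons (lebesgue_tuple m)
  else \d_ ([tuple] : 0.-tuple RR).

End lebesgue_tuple.

Section lebesgue_rV.
Context (R : realType) (d : nat).
Local Notation RR := (measurableTypeR R).

(* R^d with the Borel sigma-algebra of its norm topology. *)
Definition borel_rV := g_sigma_algebraType (@open 'rV[R]_d).

Definition row_of_tuple (t : d.-tuple RR) : borel_rV := \row_i tnth t i.

Let box (q : 'rV[rat]_d) (e : R) : set (d.-tuple RR) :=
  \bigcap_i ((fun t => tnth t i) @^-1` ball (ratr (q 0 i) : R) e).

Let measurable_box q e : measurable (box q e).
Proof.
apply: fin_bigcap_measurable => // i _.
rewrite -[X in measurable X]setTI; apply: measurable_tnth => //.
exact: open_measurable (ball_open _ _).
Qed.

Lemma measurable_row_of_tuple : measurable_fun setT row_of_tuple.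
Proof.
apply: (measurability (@open 'rV[R]_d : set (set borel_rV))) => //.
move=> _ [U oU <-]; rewrite setTI.
pose F (qm : 'rV[rat]_d * nat) : set (d.-tuple RR) :=
  if `[< box qm.1 qm.2.+1%:R^-1 `<=` row_of_tuple @^-1` U >]
  then box qm.1 qm.2.+1%:R^-1 else set0.
rewrite (_ : _ @^-1` U = \bigcup_qm F qm).
  apply: countable_bigcupT_measurable => [//|qm].
  by rewrite /F; case: ifPn.
apply/seteqP; split=> [t|t [qm _]]; last first.
  by rewrite /F; case: asboolP => // + tb; exact.
move=> /= Ut; move: (oU); rewrite openE => /(_ _ Ut)/nbhs_ballP[/= e e0 eU].
have e20 : 0 < e / 2 by rewrite divr_gt0.
have [m _ /(_ m (leqnn m))/= me] := near_infty_natSinv_lt (PosNum e20).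
have /choice[q qP] (i : 'I_d) : exists r : rat,
    ball (ratr r : R) m.+1%:R^-1 (tnth t i).
  have [|r] := @rat_in_itvoo R (tnth t i) (tnth t i + m.+1%:R^-1).
    by rewrite ltrDl invr_gt0.
  rewrite in_itv/= => /andP[h1 h2]; exists r.
  by rewrite /ball/= ltr_distl h2 andbT ltrBlDr (lt_trans h1)// ltrDl invr_gt0.
exists (\row_i q i, m) => //; rewrite /F; case: asboolP => /= [_|nsub].
  by move=> i _ /=; rewrite mxE.
case: nsub => s sb /=; apply: eU; split => // i j.
rewrite !mxE; apply: (@le_ball _ _ _ (e / 2 + e / 2)); first by rewrite -splitr.
apply: ball_triangle (le_ball (ltW me) _) (le_ball (ltW me) _).
  by apply: ball_sym; exact: qP.
by have := sb j I; rewrite /= mxE.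
Qed.

(* The d-fold product of [lebesgue_measure], carried from tuples to row vectors;
   [lebesgue_rV_box] gives its value on boxes. *)
Definition lebesgue_rV : set borel_rV -> \bar R :=
  pushforward (lebesgue_tuple R d) row_of_tuple.

HB.instance Definition _ := Measure.copy lebesgue_rV
  (measure_function_pushforward__canonical__measure_function_Measure
     (lebesgue_tuple R d) measurable_row_of_tuple).

End lebesgue_rV.

Lemma lebesgue_tuple_box (R : realType) n (a b : 'I_n -> R) :
  (forall i, a i <= b i) ->
  lebesgue_tuple R n [set t | forall i, tnth t i \in `]a i, b i[ ] =
  (\prod_i (b i - a i))%:E.
Proof.
elim: n a b => [|n IH] a b ab.
  rewrite big_ord0 /= /dirac indicE mem_set//=.
  by case.
rewrite /= /lebesgue_cons /pushforward.
set B := (X in product_measure1 _ _ X).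
have -> : B = `]a ord0, b ord0[%classic `*`
   [set t : n.-tuple (measurableTypeR R) | forall i, tnth t i \in `]a (lift ord0 i), b (lift ord0 i)[ ].
  apply/seteqP; split=> -[x t]/=.
    move=> h; split; first by have := h ord0.
    by move=> i; have := h (lift ord0 i); rewrite tnthS.
  move=> [h1 h2] i; case: (unliftP ord0 i) => [j|] ->; last by [].
  by rewrite tnthS.
rewrite product_measure1E//.
  rewrite IH// big_ord_recl EFinM; congr (_ * _)%E.
  apply: etrans (lebesgue_measure_itv _) _; rewrite /= lte_fin.
  rewrite lt_neqAle ab andbT; case: eqVneq => [->|_] /=; rewrite ?subrr ?EFinN//.
rewrite (_ : [set _ | _] = \bigcap_i ((fun t => tnth t i) @^-1` `]a (lift ord0 i), b (lift ord0 i)[)).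
  apply: fin_bigcap_measurable => // i _.
  by rewrite -[X in measurable X]setTI; apply: measurable_tnth.
by apply/seteqP; split=> t h i //=; exact: h.
Qed.

Lemma lebesgue_rV_box (R : realType) d (a b : 'rV[R]_d) :
  (forall i, a 0 i <= b 0 i) ->
  lebesgue_rV [set x : 'rV[R]_d | forall i, x 0 i \in `]a 0 i, b 0 i[ ] =
  (\prod_i (b 0 i - a 0 i))%:E.
Proof.
move=> ab; rewrite -(lebesgue_tuple_box ab); congr (lebesgue_tuple R d _).
by apply/seteqP; split=> t h i; have := h i; rewrite /= mxE.
Qed.

Record bounded_domain (R : realType) (d : nat) := BoundedDomain {
  domain_set :> set 'rV[R]_d ;
  domain_neq0 : domain_set !=set0 ;
  domain_open : open domain_set ;
  domain_connected : connected domain_set ;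
  domain_bounded : bounded_set domain_set }.

Section L2.
Context (R : realType) (d : nat) (Omega : bounded_domain R d).

Lemma measurable_domain : measurable (Omega : set (borel_rV R d)).
Proof. by apply: sub_sigma_algebra; exact: domain_open. Qed.

(* Lebesgue measure on Omega, as the measure A |-> lebesgue_rV (A `&` Omega) on
   the whole of R^d. *)
Definition domain_measure := mrestr (@lebesgue_rV R d) measurable_domain.

HB.instance Definition _ := Measure.on domain_measure.

(* Square-integrable functions on Omega, not quotiented by a.e. equality, because
   the library provides the vector space structure on [LfunType] only.
   [L2dot] and [L2norm] take the same values on a.e. equal functions. *)
Definition L2 := LfunType domain_measure (lee1n 2).

HB.instance Definition _ := GRing.Lmodule.on L2.

Definition L2fun (f : L2) : borel_rV R d -> R := f.

Definition L2dot (f g : L2) : R :=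
  \int[domain_measure]_x (L2fun f x * L2fun g x).

Definition L2norm (f : L2) : R :=
  fine ('N[domain_measure]_2%:E[EFin \o L2fun f])%E.

Definition L2_continuous (T : R) (u : R -> L2) :=
  forall t : R, 0 <= t <= T ->
    L2norm (u s - u t) @[s --> within `[0, T] (nbhs t)] --> 0.

End L2.

Definition Gamma (R : realType) (x : R) : R :=
  \int[@lebesgue_measure R]_(t in `]0, +oo[) (t `^ (x - 1) * expR (- t)).

Section scheme.
Context (R : realType) (V : lmodType R) (alpha dt : R).

Definition coef_a (j : nat) : R :=
  - (3 / 2) * (2 - alpha) * j.+1%:R `^ (1 - alpha)
  + 1 / 2 * (2 - alpha) * j%:R `^ (1 - alpha)
  + j.+1%:R `^ (2 - alpha) - j%:R `^ (2 - alpha).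

Definition coef_b (j : nat) : R :=
  2 * (2 - alpha) * j.+1%:R `^ (1 - alpha)
  - 2 * j.+1%:R `^ (2 - alpha) + 2 * j%:R `^ (2 - alpha).

Definition coef_c (j : nat) : R :=
  - (1 / 2) * (2 - alpha) * (j.+1%:R `^ (1 - alpha) + j%:R `^ (1 - alpha))
  + j.+1%:R `^ (2 - alpha) - j%:R `^ (2 - alpha).

(* The value at k = 0 is a placeholder. *)
Definition L2_operator (u : nat -> V) (k : nat) : V :=
  match k with
  | 0 => 0
  | 1 => (Gamma (2 - alpha) * dt `^ alpha)^-1 *: (u 1%N - u 0%N)
  | _ => (Gamma (3 - alpha) * dt `^ alpha)^-1 *:
      (\sum_(1 <= j < k) (coef_a j *: u (k - j - 1)%N + coef_b j *: u (k - j)%N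
                          + coef_c j *: u (k - j + 1)%N)
       + (alpha / 2) *: u (k - 2)%N - 2 *: u (k - 1)%N
       + ((4 - alpha) / 2) *: u k)
  end.

Definition diff_quot (u : nat -> V) (k : nat) : V :=
  if k is k'.+1 then dt^-1 *: (u k'.+1 - u k') else 0.

End scheme.

(* Main.v *)
Require Import Defs.
From mathcomp Require Import all_boot all_order all_algebra.
From mathcomp Require Import all_classical all_reals all_analysis measurable_realfun.
From mathcomp Require Import ring lra.
Import Order.TTheory GRing.Theory Num.Theory numFieldNormedType.Exports.
Local Open Scope classical_set_scope.
Local Open Scope ring_scope.

(** Put E_k = 3 D_k - D_(k-1) and w = dt^(1-alpha) / Gamma(3-alpha).  Rewritten in
    the difference quotients, the scheme is
      L_k = w (alpha D_k - alpha/2 D_(k-1) + sum_(j<k) kappa_j D_(k-j) - c_k D_1),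
    with an extra - w alpha/2 D_1 when k = 1, where kappa_j is the second
    difference x(j) - 2 x(j+1) + x(j+2) of
    x(t) = t^(2-alpha) - (2-alpha)/2 t^(1-alpha) ([L2_operator_convolution]; the
    case k = 1 is where Gamma(3-alpha) = (2-alpha) Gamma(2-alpha) enters).

    The memory term is handled through geometric kernels.  For r in [0,1] let
    v_k = sum_(j<k) r^j D_(k-j), so that D_k = v_k - r v_(k-1).  Then
    <v_k, E_k> is affine in r between <v_k, 3 v_k - v_(k-1)> at r = 0 and the BDF2
    form <v_k, 3 v_k - 4 v_(k-1) + v_(k-2)> at r = 1; both are an increment of a
    nonnegative energy plus squares ([bdf2_energy_step]), and summing gives at
    least |D_1|^2 / 2 ([geometric_convolution_ge0]).  The sum over k is a
    polynomial in r with coefficients q_j = sum_k <D_(k-j), E_k>, so the same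
    bound, times kappa_0, holds for sum_j q_j kappa_j whenever the functional
    X^j |-> kappa_j is nonnegative on the polynomials that are nonnegative on
    [0,1], that is when kappa is a Hausdorff moment sequence
    ([moment_convolution_ge0]).

    That property of kappa comes from the Laplace transform: (m+x)^(-1-s) is, up
    to the positive factor Gamma(1+s), the integral of t^s e^(-xt) (e^(-t))^m, so
    pairing it with q gives the integral of t^s e^(-xt) q(e^(-t)) >= 0
    ([power_pairing_laplace_ge0]).  The mean value theorem in x raises the
    exponent step by step up to 2-alpha ([power_pairing_diff2_ge0],
    [power_pairing_diff2_le0]).

    The remaining terms are local in time, except for c_k D_1, and c_k is a
    trapezoidal quadrature error of size alpha (1-alpha) / (2k)
    ([coef_c_bound]), hence square summable with a small sum.  Completing squares
    ([history_term_step]) leaves alpha/2 sum_k |D_k|^2 plus a multiple of |D_1|^2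
    whose coefficient is nonnegative ([l2_energy]). *)

(** * Gamma integrals and Laplace transforms of powers *)

Section gamma_integral.
Context {R : realType}.
Local Notation mu := (@lebesgue_measure R).
Implicit Types s t x : R.

Definition gamma_integrand s t : R := t `^ s * expR (- t).

Lemma measurable_gamma_integrand s (D : set (measurableTypeR R)) :
  measurable_fun D (gamma_integrand s).
Proof.
apply: measurable_funTS; apply: measurable_funM; first exact: measurable_powR.
exact: measurableT_comp.
Qed.

Lemma emeasurable_gamma_integrand s (D : set (measurableTypeR R)) :
  measurable_fun D (fun t => (gamma_integrand s t)%:E).
Proof. by apply/measurable_EFinP; exact: measurable_gamma_integrand. Qed.

Lemma gamma_integrand_ge0 s t : 0 <= gamma_integrand s t.
Proof. by rewrite mulr_ge0 ?powR_ge0 ?expR_ge0. Qed.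

(** An explicit integrable majorant: it gives at once the decay at infinity, the
    finiteness of the Gamma integrals, and an additive correction that turns the
    sign-changing derivative of t^s e^(-t) into a nonnegative function. *)
Lemma gamma_integrand_le s t : 0 <= s <= 2 -> 0 <= t ->
  gamma_integrand s t <= 16 * expR (- (t / 2)).
Proof.
move=> /andP[s0 s2] t0.
have -> : 16 * expR (- (t / 2)) = 16 * expR (t / 2) * expR (- t).
  by rewrite -mulrA -expRD; congr (_ * expR _); lra.
rewrite ler_wpM2r ?expR_ge0//.
(* The constant 16 comes from 1 + t^2 <= 16 (1 + t/4)^2 <= 16 e^(t/2). *)
have ts : t `^ s <= 1 + t ^+ 2.
  have [t1|/ltW t1] := leP t 1.
    have -> : 1 + t ^+ 2 = 1 `^ s + t ^+ 2 by rewrite powR1.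
    by rewrite ler_wpDr ?sqr_ge0// ge0_ler_powR// nnegrE.
  by rewrite ler_wpDl// -powR_mulrn// ler_powR.
apply: (le_trans ts).
have h : 1 + t / 4 <= expR (t / 4) by exact: expR_ge1Dx.
have -> : expR (t / 2) = expR (t / 4) * expR (t / 4).
  by rewrite -expRD; congr expR; lra.
have : (1 + t / 4) * (1 + t / 4) <= expR (t / 4) * expR (t / 4).
  by apply: ler_pM => //; lra.
by nra.
Qed.

Lemma cvgr_expR_half : expR (- (t / 2)) @[t --> +oo] --> (0 : R).
Proof.
have half : (fun t : R => t / 2) t @[t --> +oo] --> +oo.
  by apply: gt0_cvgMly; [rewrite invr_gt0|exact: cvg_id].
exact: (cvg_comp (fun t : R => t / 2) (fun t => expR (- t)) half (@cvgr_expR R)).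
Qed.

Lemma continuous_expR_half (c : R) :
  continuous (fun t : R => c * expR (- (t / 2))).
Proof.
by move=> t; apply/differentiable_continuous/derivable1_diffP; exact: ex_derive.
Qed.

Lemma cvgr_gamma_integrand s : 0 <= s <= 2 ->
  gamma_integrand s t @[t --> +oo] --> (0 : R).
Proof.
move=> s02; apply: (@squeeze_cvgr _ _ _ _ (cst 0)
  (fun t => 16 * expR (- (t / 2)))).
- near=> t; have t0 : 0 <= t by near: t; exact: nbhs_pinfty_ge.
  by rewrite /= gamma_integrand_ge0 gamma_integrand_le.
- exact: cvg_cst.
- by rewrite -(mulr0 16); apply: cvgMr; exact: cvgr_expR_half.
Unshelve. all: by end_near. Qed.

Lemma continuous_powR_itvcy s : 0 < s ->
  {within `[0, +oo[, continuous (@powR R ^~ s)}.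
Proof.
move=> s0; apply/continuous_within_itvcyP; split.
  move=> t; rewrite in_itv/= andbT => t0.
  apply: differentiable_continuous; apply/derivable1_diffP.
  by apply: ex_derive; exact: is_derive1_powR.
by rewrite powR0 ?gt_eqF//; exact: powR_cvg0.
Qed.

Lemma continuous_gamma_integrand s : 0 < s ->
  {within `[0, +oo[, continuous (gamma_integrand s)}.
Proof.
move=> s0 t; apply: cvgM; first exact: continuous_powR_itvcy.
apply: continuous_subspaceT => {}t; apply: continuous_comp.
  exact: continuousN.
exact: continuous_expR.
Qed.

Lemma integral_expR_half :
  (\int[mu]_(t in `[0%R, +oo[) (16 * expR (- (t / 2)))%:E = 32%:E)%E.
Proof.
rewrite (@ge0_continuous_FTC2y _ _ (fun t => - 32 * expR (- (t / 2))) 0 0).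
- by rewrite mul0r oppr0 expR0 mulr1 -EFinB; congr EFin; lra.
- by move=> t t0; rewrite mulr_ge0 ?expR_ge0.
- apply: derivable_within_continuous => t _; exact: ex_derive.
- by rewrite -(mulr0 (- 32)); apply: cvgMr; exact: cvgr_expR_half.
- by move=> t t0; exact: ex_derive.
- by apply: cvg_at_right_filter; exact: continuous_expR_half.
- move=> t _; rewrite derive1E derive_val.
  by rewrite /GRing.scale/=; lra.
Qed.

Lemma is_derive_gamma_integrand s t : 0 < t ->
  is_derive t 1 (gamma_integrand s)
    (s * gamma_integrand (s - 1) t - gamma_integrand s t).
Proof.
move=> t0; have dp := is_derive1_powR s t0.
apply: is_derive_eq; rewrite /GRing.scale/= /gamma_integrand.
by ring.
Qed.

(** Integration by parts on the half-line.  The fundamental theorem of calculus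
    is applied to t^s e^(-t) - 32 e^(-t/2) rather than to t^s e^(-t): its
    derivative is nonnegative, so the integral over an unbounded interval needs
    no prior integrability, and both sides gain the same finite amount 32. *)
Lemma integral_gamma_integrandS s : 1 < s <= 2 ->
  (\int[mu]_(t in `[0%R, +oo[) (gamma_integrand s t)%:E =
   s%:E * \int[mu]_(t in `[0%R, +oo[) (gamma_integrand (s - 1) t)%:E)%E.
Proof.
move=> /andP[s1 s2]; have s0 : 0 < s by lra.
have s02 : 0 <= s <= 2 by rewrite s2 ltW.
pose f t := s * gamma_integrand (s - 1) t +
  (16 * expR (- (t / 2)) - gamma_integrand s t).
pose F t := gamma_integrand s t - 32 * expR (- (t / 2)).
have dF t : 0 < t -> is_derive t 1 F (f t).
  move=> t0; have dg := is_derive_gamma_integrand s t t0.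
  by apply: is_derive_eq; rewrite /f /GRing.scale/=; lra.
have f0 t : 0 <= t -> 0 <= f t.
  move=> t0; apply: addr_ge0; last by rewrite subr_ge0 gamma_integrand_le.
  by apply: mulr_ge0; [exact: ltW|exact: gamma_integrand_ge0].
have cf : {within `[0, +oo[, continuous f}.
  move=> t; apply: cvgD; last apply: cvgB.
  - by apply: cvgMr; apply: continuous_gamma_integrand; rewrite subr_gt0.
  - exact: (continuous_subspaceT (continuous_expR_half 16)).
  - exact: continuous_gamma_integrand.
have If : (\int[mu]_(t in `[0%R, +oo[) (f t)%:E = 32%:E)%E.
  rewrite (@ge0_continuous_FTC2y _ f F 0 0)//.
  - rewrite /F /gamma_integrand powR0 ?gt_eqF// !mul0r oppr0 expR0.
    by rewrite -EFinB; congr EFin; lra.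
  - rewrite -[0]subr0; apply: cvgB; first exact: cvgr_gamma_integrand.
    by rewrite -(mulr0 32); apply: cvgMr; exact: cvgr_expR_half.
  - by move=> t t0; have := dF t t0 => ?; exact: ex_derive.
  - apply: cvgB; last by apply: cvg_at_right_filter; exact: continuous_expR_half.
    by have /continuous_within_itvcyP[] := continuous_gamma_integrand s s0.
  - move=> t; rewrite in_itv/= andbT => t0; have := dF t t0 => ?.
    by rewrite derive1E derive_val.
have mE (D : set (measurableTypeR R)) :
    measurable_fun D (fun t : R => 16 * expR (- (t / 2))).
  by have := continuous_measurable_fun (continuous_expR_half 16);
    exact: measurable_funTS.
have mf (D : set (measurableTypeR R)) : measurable_fun D f.
  apply: measurable_funD.
    by apply: measurable_funM => //; exact: measurable_gamma_integrand.
  by apply: measurable_funB; [exact: mE|exact: measurable_gamma_integrand].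
rewrite -ge0_integralZl_EFin ?(ltW s0)//; last 2 first.
- by move=> t _; rewrite lee_fin gamma_integrand_ge0.
- exact: emeasurable_gamma_integrand.
set A := (\int[mu]_(t in _) _)%E; set B := (\int[mu]_(t in _) _)%E.
suff : (32%:E + A = B + 32%:E)%E.
  by move=> AB; rewrite -(@addeK _ 32%:E A)// [(A + _)%E]addeC AB addeK.
have If0 (g : R -> R) : (forall t, 0 <= g t) ->
    (forall t : R, `[0%R, +oo[%classic t -> (0%R <= (g t)%:E)%E).
  by move=> g0 t _; rewrite lee_fin.
rewrite -[in LHS]If -[in RHS]integral_expR_half /A /B.
rewrite -[LHS]ge0_integralD; last 5 first.
- exact: measurable_itv.
- by move=> t; rewrite /= in_itv/= andbT => t0; rewrite lee_fin f0.
- by apply/measurable_EFinP; exact: mf.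
- by apply: If0; exact: gamma_integrand_ge0.
- exact: emeasurable_gamma_integrand.
rewrite -[RHS]ge0_integralD; last 5 first.
- exact: measurable_itv.
- by move=> t _; rewrite -EFinM lee_fin mulr_ge0 ?gamma_integrand_ge0// ltW.
- by apply/measurable_EFinP/measurable_funM => //;
    exact: measurable_gamma_integrand.
- by apply: If0 => t; rewrite mulr_ge0 ?expR_ge0.
- by apply/measurable_EFinP; exact: mE.
apply: eq_integral => t _; rewrite -EFinM -!EFinD /f; congr EFin.
lra.
Qed.

Definition gamma_moment s : R :=
  fine (\int[mu]_(t in `[0%R, +oo[) (gamma_integrand s t)%:E)%E.

Lemma gamma_momentE s : 0 <= s <= 2 ->
  (\int[mu]_(t in `[0%R, +oo[) (gamma_integrand s t)%:E =
   (gamma_moment s)%:E)%E.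
Proof.
move=> s02; rewrite /gamma_moment fineK// ge0_fin_numE; last first.
  by apply: integral_ge0 => t _; rewrite lee_fin gamma_integrand_ge0.
apply: (@le_lt_trans _ _ 32%:E); last by rewrite ltry.
rewrite -integral_expR_half; apply: ge0_le_integral.
- exact: measurable_itv.
- by move=> t _; rewrite lee_fin gamma_integrand_ge0.
- exact: emeasurable_gamma_integrand.
- have := continuous_measurable_fun (continuous_expR_half 16).
  by move=> h; apply/measurable_EFinP; exact: measurable_funTS.
- move=> t; rewrite /= in_itv/= andbT => t0.
  by rewrite lee_fin gamma_integrand_le.
Qed.

Lemma gamma_moment_gt0 s : 0 <= s <= 2 -> 0 < gamma_moment s.
Proof.
move=> s02; rewrite -lte_fin -gamma_momentE//.
apply: (@lt_le_trans _ _ (expR (- 2))%:E); first by rewrite lte_fin expR_gt0.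
apply: (@le_trans _ _ (\int[mu]_(t in `[1%R, 2%R]) (gamma_integrand s t)%:E)%E).
  have -> : ((expR (- 2))%:E = \int[mu]_(t in `[1%R, 2%R]) (expR (- 2))%:E)%E.
    rewrite integral_cst//= lebesgue_measure_itv/= lte_fin ltr1n -EFinB -EFinM.
    by congr EFin; lra.
  apply: ge0_le_integral => //.
  - exact: emeasurable_gamma_integrand.
  - move=> t; rewrite /= in_itv/= => /andP[t1 t2]; rewrite lee_fin.
    rewrite -[leLHS]mul1r ler_pM ?expR_ge0 ?ler_expR ?lerN2//.
    by rewrite -(powRr0 t) ler_powR//; case/andP: s02.
apply: ge0_subset_integral => //.
- exact: emeasurable_gamma_integrand.
- by move=> t _; rewrite lee_fin gamma_integrand_ge0.
- move=> t; rewrite /= !in_itv/= andbT => /andP[t1 _].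
  exact: le_trans t1.
Qed.

(** The substitution t |-> xt in the Gamma integral: negative powers are
    Laplace transforms of positive functions. *)
Lemma laplace_powR s x : 0 < s <= 2 -> 0 < x ->
  (\int[mu]_(t in `[0%R, +oo[) (t `^ s * expR (- (x * t)))%:E =
   (x `^ (- (1 + s)) * gamma_moment s)%:E)%E.
Proof.
move=> /andP[s0 s2] x0.
have s02 : 0 <= s <= 2 by rewrite s2 ltW.
have dF (t : R) : is_derive t 1 (fun t => x * t) x.
  by apply: is_derive_eq; rewrite /GRing.scale/= mulr1.
have F'E : derive1 (fun t : R => x * t) = cst x.
  by apply/funext => t; rewrite derive1E derive_val.
have x2y : (fun t : R => x * t) t @[t --> +oo] --> +oo.
  by apply: gt0_cvgMry => //; exact: cvg_id.
have G0 : {in `](x * 0), +oo[, forall t, 0 <= gamma_integrand s t}.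
  by move=> t _; exact: gamma_integrand_ge0.
have subst_eq : (\int[mu]_(t in `[(x * 0)%R, +oo[) (gamma_integrand s t)%:E =
    \int[mu]_(t in `[0%R, +oo[)
      (((gamma_integrand s \o *%R x) * derive1 (fun t : R => x * t)) t)%:E)%E.
  apply: increasing_ge0_integration_by_substitutiony => //.
  - by move=> t1 t2 _ _ t12; rewrite ltr_pM2l.
  - by move=> t _; rewrite F'E; exact: cvg_cst.
  - by rewrite F'E; exact: is_cvg_cst.
  - by rewrite F'E; exact: is_cvg_cst.
  - split; first by move=> t _; have := dF t => ?; exact: ex_derive.
    apply: cvg_at_right_filter; apply: cvgMr; exact: cvg_id.
  - by rewrite mulr0; exact: continuous_gamma_integrand.
move: subst_eq; rewrite mulr0 gamma_momentE// => subst_eq.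
have xs : x `^ (- (1 + s)) * (x `^ s * x) = 1.
  rewrite -{3}(powRr1 (ltW x0)) -!powRD ?(gt_eqF x0) ?implybT//.
  have -> : - (1 + s) + (s + 1) = 0 by lra.
  by rewrite powRr0.
have -> : (x `^ (- (1 + s)) * gamma_moment s)%:E =
    ((x `^ (- (1 + s)))%:E * (gamma_moment s)%:E)%E by rewrite EFinM.
rewrite subst_eq -ge0_integralZl_EFin//=.
- apply: eq_integral => t; rewrite inE/= in_itv/= andbT => t0.
  rewrite F'E -EFinM; congr EFin.
  rewrite -[((_ \o _) * _) t]/(gamma_integrand s (x * t) * x).
  rewrite /gamma_integrand powRM ?(ltW x0)//.
  by rewrite -[LHS]mul1r -[X in X * _ = _]xs; ring.
- move=> t _; rewrite lee_fin F'E mulr_ge0 ?(ltW x0)//.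
  exact: gamma_integrand_ge0.
- apply/measurable_EFinP/measurable_funTS; rewrite F'E.
  apply: measurable_funM => //; apply: measurableT_comp.
    exact: measurable_gamma_integrand.
  exact: mulrl_measurable.
- exact: powR_ge0.
Qed.

End gamma_integral.

Lemma Gamma_gamma_moment {R : realType} (x : R) :
  Gamma x = gamma_moment (x - 1).
Proof.
rewrite /Gamma /gamma_moment /Rintegral; congr fine.
by apply: integral_itv_obnd_cbnd; exact: emeasurable_gamma_integrand.
Qed.

Lemma GammaS {R : realType} (x : R) : 1 < x <= 2 -> Gamma (x + 1) = x * Gamma x.
Proof.
move=> x12; rewrite !Gamma_gamma_moment addrK /gamma_moment.
rewrite integral_gamma_integrandS// -[RHS]/(fine x%:E * _) -fineM//.
case/andP: x12 => x1 x2; rewrite gamma_momentE//; apply/andP; split; lra.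
Qed.

Lemma Gamma_ge0 {R : realType} (x : R) : 0 <= Gamma x.
Proof. by apply: Rintegral_ge0 => t _; exact: gamma_integrand_ge0. Qed.

(** * Powers as Hausdorff moment sequences *)

(** To be read as a linear functional of [q]: that it is nonnegative on the
    polynomials that are nonnegative on [0, 1] means that [f] is a Hausdorff
    moment sequence. *)
Definition pairing {R : nzRingType} (f : nat -> R) (q : {poly R}) : R :=
  \sum_(i < size q) q`_i * f i.

Lemma pairing_widen {R : nzRingType} (f : nat -> R) (q : {poly R}) n :
  (size q <= n)%N -> pairing f q = \sum_(i < n) q`_i * f i.
Proof.
move=> qn; rewrite /pairing (big_ord_widen n (fun i => q`_i * f i) qn) big_mkcond.
by apply: eq_bigr => i _; case: ltnP => // h; rewrite nth_default ?mul0r.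
Qed.

Lemma pairing_poly {R : nzRingType} (f : nat -> R) n (E : nat -> R) :
  pairing f (\poly_(i < n) E i) = \sum_(i < n) E i * f i.
Proof.
rewrite (@pairing_widen _ _ _ n) ?size_poly//.
by apply: eq_bigr => i _; rewrite coef_poly ltn_ord.
Qed.

Section completely_monotone.
Context {R : realType}.
Local Notation mu := (@lebesgue_measure R).
Implicit Types (q : {poly R}) (s x y : R).

Definition unit_nonneg q := forall r : R, 0 <= r <= 1 -> 0 <= q.[r].

Definition power_pairing s x q := pairing (fun m : nat => (m%:R + x) `^ s) q.

(** The pairing is the integral of t^s e^(-xt) q(e^(-t)) divided by a positive
    Gamma value, and e^(-t) stays in [0,1]. *)
Lemma power_pairing_laplace_ge0 s x q : 0 < s <= 2 -> 0 < x ->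
  unit_nonneg q -> 0 <= power_pairing (- (1 + s)) x q.
Proof.
move=> s02 x0 q0; have s02' : 0 <= s <= 2 by case/andP: s02 => /ltW -> ->.
(* Multiplying by the Gamma value turns each power into a Laplace integral. *)
rewrite -(pmulr_rge0 _ (gamma_moment_gt0 _ s02')) -lee_fin.
pose h (m : nat) (t : R) := t `^ s * expR (- ((m%:R + x) * t)).
have mx0 (m : nat) : 0 < m%:R + x by rewrite ltr_wpDl.
have Ih m : (\int[mu]_(t in `[0%R, +oo[) (h m t)%:E =
    ((m%:R + x) `^ (- (1 + s)) * gamma_moment s)%:E)%E.
  by rewrite laplace_powR.
have h0 m t : 0 <= h m t by rewrite mulr_ge0 ?powR_ge0 ?expR_ge0.
have ih m : mu.-integrable `[0, +oo[ (EFin \o h m).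
  apply/integrableP; split.
    apply/measurable_EFinP/measurable_funTS; apply: measurable_funM.
      exact: measurable_powR.
    apply: continuous_measurable_fun => t.
    by apply/differentiable_continuous/derivable1_diffP; exact: ex_derive.
  under eq_integral do rewrite /= ger0_norm//.
  by rewrite Ih ltry.
have -> : (gamma_moment s * power_pairing (- (1 + s)) x q)%:E =
    (\sum_(m < size q) \int[mu]_(t in `[0%R, +oo[) ((q`_m)%:E * (h m t)%:E))%E.
  rewrite mulr_sumr -sumEFin; apply: eq_bigr => m _.
  rewrite integralZl//; last exact: ih.
  by rewrite Ih -EFinM; congr EFin; ring.
rewrite -integral_sum//; last by move=> m; apply: integrableZl => //; exact: ih.
apply: integral_ge0 => t; rewrite /= in_itv/= andbT => t0.
under eq_bigr do rewrite -EFinM; rewrite sumEFin lee_fin.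
have -> : \sum_(m < size q) q`_m * h m t =
    t `^ s * expR (- (x * t)) * q.[expR (- t)].
  rewrite horner_coef mulr_sumr; apply: eq_bigr => m _; rewrite /h.
  have -> : expR (- ((m%:R + x) * t)) = expR (- t) ^+ m * expR (- (x * t)).
    by rewrite -expRM_natl -expRD; congr expR; ring.
  by ring.
rewrite mulr_ge0 ?mulr_ge0 ?powR_ge0 ?expR_ge0//; apply: q0.
by rewrite expR_ge0 -expR0 ler_expR oppr_le0.
Qed.

Lemma is_derive_shifted_powR s c x : 0 < c + x ->
  is_derive x 1 (fun y => (c + y) `^ s) (s * (c + x) `^ (s - 1)).
Proof.
move=> cx0; have dp := is_derive1_powR s cx0.
have dc : is_derive x 1 (fun y => c + y) 1.
  rewrite (_ : (fun y => c + y) = shift c); first exact: is_derive_shift.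
  by apply/funext => y; exact: addrC.
have := @is_derive1_comp _ (@powR R ^~ s) (fun y => c + y) x _ _ dp dc.
by rewrite mulr1.
Qed.

Lemma power_pairingE s q : power_pairing s ^~ q =
  \sum_(i < size q) (fun x => q`_i * (i%:R + x) `^ s).
Proof. by rewrite fct_sumE. Qed.

Lemma is_derive_power_pairing s x q : 0 < x ->
  is_derive x 1 (power_pairing s ^~ q) (s * power_pairing (s - 1) x q).
Proof.
move=> x0; rewrite power_pairingE.
have -> : s * power_pairing (s - 1) x q =
    \sum_(i < size q) q`_i * (s * (i%:R + x) `^ (s - 1)).
  by rewrite mulr_sumr; apply: eq_bigr => i _; ring.
apply: is_derive_sum => i.
have ix0 : 0 < i%:R + x by rewrite ltr_wpDl.
have dp := is_derive_shifted_powR s i%:R x ix0.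
by apply: is_derive_eq; rewrite /GRing.scale/=; ring.
Qed.

Lemma continuous_power_pairing s q : 0 < s ->
  {within `[0, +oo[, continuous (power_pairing s ^~ q)}.
Proof.
move=> s0; rewrite power_pairingE.
apply: (big_ind (fun f : R -> R => {within `[0, +oo[, continuous f})).
- by apply: continuous_subspaceT => x; exact: cvg_cst.
- by move=> f g cf cg x; apply: cvgD; [exact: cf|exact: cg].
move=> i _; suff ci : {within `[0, +oo[, continuous (fun x => (i%:R + x) `^ s)}.
  by move=> x; apply: cvgMr; exact: ci.
case: (val i) => [|m]; last first.
  apply: derivable_within_continuous => x; rewrite in_itv/= andbT => x0.
  have mx0 : 0 < m.+1%:R + x by rewrite ltr_pwDl.
  by have dp := is_derive_shifted_powR s m.+1%:R x mx0; exact: ex_derive.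
rewrite (_ : (fun x => _) = @powR R ^~ s); first exact: continuous_powR_itvcy.
by apply/funext => x; rewrite add0r.
Qed.

(** Differentiation in the shift lowers the exponent by one and keeps the
    polynomial; at a = 0 a positive exponent is required for continuity. *)
Lemma power_pairing_mvt s a b q : 0 <= a < b -> (0 < a) || (0 < s) ->
  exists2 x, a < x < b & power_pairing s b q - power_pairing s a q =
    s * power_pairing (s - 1) x q * (b - a).
Proof.
move=> /andP[a0 ab] as0.
have [x||x] := @MVT R (power_pairing s ^~ q)
  (fun x => s * power_pairing (s - 1) x q) a b ab.
- rewrite in_itv/= => /andP[ax _].
  by apply: is_derive_power_pairing; exact: le_lt_trans ax.
- case/orP: as0 => [a0'|s0].
    apply: derivable_within_continuous => x; rewrite in_itv/= => /andP[ax _].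
    have x0 : 0 < x by exact: lt_le_trans ax.
    by have dp := is_derive_power_pairing s x q x0; exact: ex_derive.
  apply: continuous_subspaceW (continuous_power_pairing s q s0) => x.
  rewrite /= !in_itv/= andbT => /andP[ax _]; exact: le_trans ax.
- by rewrite in_itv/= => axb ->; exists x.
Qed.

(** As a function of the shift, the pairing is nonincreasing, because its
    derivative is - s times the pairing with exponent - (1 + s), and it tends to 0
    at infinity. *)
Lemma power_pairing_neg_ge0 s x q : 0 < s <= 2 -> 0 < x ->
  unit_nonneg q -> 0 <= power_pairing (- s) x q.
Proof.
move=> s02 x0 q0; have s0 : 0 < s by case/andP: s02.
have decr y : x < y -> power_pairing (- s) y q <= power_pairing (- s) x q.
  move=> xy.
  have [|//|z /andP[xz _] E] := @power_pairing_mvt (- s) x y q.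
  - by rewrite (ltW x0).
  - by rewrite x0.
  have z0 : 0 < z by exact: lt_trans xz.
  have := power_pairing_laplace_ge0 s z q s02 z0 q0.
  have -> : - (1 + s) = - s - 1 by lra.
  move=> h; rewrite -subr_le0 E !mulNr oppr_le0.
  by apply: mulr_ge0; [apply: mulr_ge0 => //|rewrite subr_ge0]; exact: ltW.
pose S := \sum_(i < size q) `|q`_i|.
have S0 : 0 <= S by rewrite sumr_ge0.
have low y : 0 < y -> - (S * y `^ (- s)) <= power_pairing (- s) y q.
  move=> y0; rewrite /S mulr_suml -sumrN /power_pairing /pairing.
  apply: ler_sum => i _; rewrite -mulNr.
  have iy0 : 0 < i%:R + y by rewrite ltr_wpDl.
  have le_pow : (i%:R + y) `^ (- s) <= y `^ (- s).
    rewrite !powRN lef_pV2 ?posrE ?powR_gt0//.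
    by rewrite ge0_ler_powR ?nnegrE ?(ltW s0) ?(ltW iy0) ?(ltW y0)// lerDr.
  have pow0 : 0 <= (i%:R + y) `^ (- s) by rewrite powR_ge0.
  have q1 := ler_norm (- q`_i); rewrite normrN in q1.
  have : - q`_i * (i%:R + y) `^ (- s) <= `|q`_i| * y `^ (- s).
    apply: (@le_trans _ _ (`|q`_i| * (i%:R + y) `^ (- s))).
      by rewrite ler_wpM2r.
    by rewrite ler_wpM2l.
  by rewrite !mulNr; lra.
rewrite leNgt; apply/negP => neg.
set e := power_pairing (- s) x q in neg *.
(* At this shift the lower bound - S y^(-s) already exceeds the supposed
   negative value e. *)
pose y := ((S + 1) / - e) `^ (s^-1) + x.
have b0 : 0 < (S + 1) / - e by rewrite divr_gt0 ?oppr_gt0// ltr_wpDl.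
have xy : x < y by rewrite ltrDr powR_gt0.
have y0 : 0 < y by exact: lt_trans xy.
have ys : (S + 1) / - e <= y `^ s.
  have -> : (S + 1) / - e = (((S + 1) / - e) `^ (s^-1)) `^ s.
    by rewrite -powRrM mulVf ?gt_eqF// powRr1// ltW.
  rewrite ge0_ler_powR ?nnegrE ?powR_ge0 ?(ltW s0) ?(ltW y0)//.
  by rewrite lerDl ltW.
have := le_trans (low y y0) (decr y xy); rewrite -/e powRN.
have ys0 : 0 < y `^ s by rewrite powR_gt0.
rewrite lerNl => h.
have h1 : - e * y `^ s <= S by rewrite -ler_pdivlMr.
move: ys; rewrite ler_pdivrMr ?oppr_gt0//; rewrite mulrC in h1.
by move=> /le_trans /(_ h1); lra.
Qed.

(** Multiplication by 'X - 1 on polynomials is dual to the forward difference on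
    sequences. *)
Lemma pairing_mulXB1 (f : nat -> R) q :
  pairing f (('X - 1) * q) = pairing (fun m => f m.+1 - f m) q.
Proof.
rewrite (@pairing_widen _ _ _ (size q).+1); last first.
  by rewrite (leq_trans (size_polyMleq _ _))// -[1]/(1%:P) size_XsubC.
under eq_bigr do rewrite mulrBl mul1r coefB mulrBl coefXM.
rewrite sumrB big_ord_recl/= mul0r add0r [X in _ - X]big_ord_recr/=.
rewrite [q`_(size q)]nth_default// mul0r addr0 -sumrB /pairing.
by apply: eq_bigr => i _; rewrite mulrBr.
Qed.

Lemma power_pairing_mulXB1 s x q :
  power_pairing s x (('X - 1) * q) =
  power_pairing s (x + 1) q - power_pairing s x q.
Proof.
rewrite /power_pairing pairing_mulXB1 /pairing -sumrB.
apply: eq_bigr => i _; rewrite mulrBr; congr (_ * _ `^ _ - _).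
by rewrite -natr1; ring.
Qed.

(** The forward difference in the shift is s times a pairing with the exponent
    s - 1, which is negative. *)
Lemma power_pairing_diff_ge0 s x q : 0 < s < 1 -> 0 <= x ->
  unit_nonneg q -> 0 <= power_pairing s x (('X - 1) * q).
Proof.
move=> /andP[s0 s1] x0 q0; rewrite power_pairing_mulXB1.
have [||y /andP[xy _] ->] := @power_pairing_mvt s x (x + 1) q.
- by rewrite x0 ltrDl ltr01.
- by rewrite s0 orbT.
have -> : x + 1 - x = 1 by lra.
rewrite mulr1 mulr_ge0 ?(ltW s0)//.
have -> : s - 1 = - (1 - s) by lra.
apply: power_pairing_neg_ge0 => //; first by apply/andP; split; lra.
exact: le_lt_trans xy.
Qed.

(** One difference is spent on lowering the exponent from ]1, 2[ to ]0, 1[, where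
    the other one has a sign. *)
Lemma power_pairing_diff2_ge0 s q : 1 < s < 2 -> unit_nonneg q ->
  0 <= power_pairing s 0 (('X - 1) * (('X - 1) * q)).
Proof.
move=> /andP[s1 s2] q0; rewrite power_pairing_mulXB1 add0r.
have s0 : 0 < s by lra.
have [||y /andP[y0 _] ->] := @power_pairing_mvt s 0 1 (('X - 1) * q).
- by rewrite lexx ltr01.
- by rewrite s0 orbT.
rewrite subr0 mulr1 mulr_ge0 ?(ltW s0)//.
by apply: power_pairing_diff_ge0 => //; [apply/andP; split; lra|exact: ltW].
Qed.

(** Since (1 - 'X) q is again nonnegative on [0, 1], this is the first-difference
    case applied to it, with the opposite sign. *)
Lemma power_pairing_diff2_le0 s q : 0 < s < 1 -> unit_nonneg q ->
  power_pairing s 0 (('X - 1) * (('X - 1) * q)) <= 0.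
Proof.
move=> s01 q0.
have /(power_pairing_diff_ge0 s 0 _ s01 (lexx 0)) :
    unit_nonneg (- (('X - 1) * q)).
  move=> r /andP[r0 r1]; rewrite -mulNr opprB hornerM !hornerE.
  by rewrite mulr_ge0 ?subr_ge0// q0 ?r0.
rewrite mulrN /power_pairing {1}/pairing size_opp.
under eq_bigr do rewrite coefN mulNr.
by rewrite sumrN oppr_ge0.
Qed.

End completely_monotone.

(** * Coefficients of the scheme *)

Section coefficients.
Context {R : realType}.
Implicit Types alpha s x y : R.

(** The weighted arithmetic-geometric mean inequality for x^s y^(1-s), divided by
    y^(1-s): a concave power lies below its tangents. *)
Lemma powR_tangent s x y : 0 < s < 1 -> 0 < x -> 0 < y ->
  x `^ s <= y `^ s + s * y `^ (s - 1) * (x - y).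
Proof.
move=> /andP[s0 s1] x0 y0; have s1' : 0 < 1 - s by rewrite subr_gt0.
have := @conjugate_powR _ (x `^ s) (y `^ (1 - s)) s^-1 (1 - s)^-1
  (powR_ge0 _ _) (powR_ge0 _ _).
rewrite !invr_gt0 !invrK => /(_ s0 s1').
rewrite -!powRrM !mulfV ?gt_eqF// !powRr1 ?(ltW x0) ?(ltW y0)//.
move=> /(_ ltac:(lra)) h.
have yy : y `^ (1 - s) * y `^ (s - 1) = 1.
  rewrite -powRD ?(gt_eqF y0) ?implybT//.
  by rewrite (_ : 1 - s + (s - 1) = 0) ?powRr0//; lra.
have ys : y * y `^ (s - 1) = y `^ s by rewrite mulr_powRB1// ltW.
have := ler_wpM2r (powR_ge0 y (s - 1)) h.
rewrite -(mulrA (x `^ s)) yy mulr1 mulrDl => /le_trans; apply.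
rewrite le_eqVlt -ys; apply/predU1P; left; ring.
Qed.

(** The reciprocal form of [powR_tangent]: x^s <= y^s (1 + h) with
    h = (s/y) (x - y), hence x^(-s) >= y^(-s) (1 - h), and y^(-s) <= 1. *)
Lemma powRN_sub_le s x y : 0 < s < 1 -> 1 <= y -> y <= x ->
  y `^ (- s) - x `^ (- s) <= s / y * (x - y).
Proof.
move=> /andP[s0 s1] y1 yx; have y0 : 0 < y by exact: lt_le_trans y1.
have x0 : 0 < x by exact: lt_le_trans yx.
have := @powR_tangent s x y; rewrite s0 s1 => /(_ isT x0 y0).
have -> : s * y `^ (s - 1) * (x - y) = s / y * (x - y) * y `^ s.
  by rewrite -(mulr_powRB1 (ltW y0) s0); field; rewrite gt_eqF.
rewrite !powRN.
have h0 : 0 <= s / y * (x - y).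
  by rewrite mulr_ge0 ?subr_ge0// divr_ge0// ltW.
move: h0; set h := s / y * (x - y) => h0 xy.
have ys1 : 1 <= y `^ s by rewrite -(powRr0 y) ler_powR// ltW.
have ys0 : 0 < y `^ s by exact: lt_le_trans ys1.
have xs0 : 0 < x `^ s by rewrite powR_gt0.
have : (x `^ s)^-1 >= (y `^ s + h * y `^ s)^-1.
  by rewrite lef_pV2 ?posrE// ltr_wpDr// mulr_ge0// ltW.
have -> : (y `^ s + h * y `^ s)^-1 = (y `^ s)^-1 * (1 + h)^-1.
  by field; rewrite !gt_eqF//; nra.
have v0 : 0 <= (y `^ s)^-1 by rewrite invr_ge0 ltW.
have v1 : (y `^ s)^-1 <= 1 by rewrite invf_le1.
have : 1 - h <= (1 + h)^-1.
  by rewrite -[leRHS]mul1r ler_pdivlMr; nra.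
move: v0 v1; set v := (y `^ s)^-1 => v0 v1 h1 h2.
have : v * (1 - h) <= v * (1 + h)^-1 by rewrite ler_wpM2l.
by nra.
Qed.

(** Up to the factor 2 - alpha, c_k is the integral of x^(1-alpha) over [k, k+1]
    minus its trapezoidal approximation.  The error F on [k, x] has a derivative
    between 0 and a multiple of x - k, by concavity of x^(1-alpha) and convexity
    of x^(-alpha). *)
Lemma coef_c_bound alpha k : 0 < alpha < 1 -> (0 < k)%N ->
  0 <= coef_c alpha k <= alpha * (1 - alpha) / (2 * k%:R).
Proof.
move=> /andP[a0 a1] k0.
have k1 : 1 <= k%:R :> R by rewrite ler1n.
have kp : 0 < k%:R :> R by exact: lt_le_trans k1.
pose F x := x `^ (2 - alpha) - k%:R `^ (2 - alpha)
  - (2 - alpha) / 2 * ((x - k%:R) * (x `^ (1 - alpha) + k%:R `^ (1 - alpha))).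
pose dF x := (2 - alpha) / 2 * (x `^ (1 - alpha) - k%:R `^ (1 - alpha)
  - (x - k%:R) * ((1 - alpha) * x `^ (- alpha))).
have Fk : F k%:R = 0 by rewrite /F; lra.
have FkS : F k.+1%:R = coef_c alpha k.
  by rewrite /F /coef_c -natr1; lra.
have derF x : 0 < x -> is_derive x 1 F (dF x).
  move=> x0; have d2 := is_derive1_powR (2 - alpha) x0.
  have d1 := is_derive1_powR (1 - alpha) x0.
  apply: is_derive_eq; rewrite /GRing.scale/= /dF.
  have -> : 2 - alpha - 1 = 1 - alpha by lra.
  have -> : 1 - alpha - 1 = - alpha by lra.
  by field.
have dF_le x : k%:R <= x -> x <= k.+1%:R -> 0 <= dF x <=
    (2 - alpha) * (1 - alpha) * alpha / (2 * k%:R) * (x - k%:R).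
  rewrite -natr1 => kx xk; have x0 : 0 < x by exact: lt_le_trans kx.
  have s01 : 0 < 1 - alpha < 1 by apply/andP; split; lra.
  have a01 : 0 < alpha < 1 by rewrite a0.
  have t1 := powR_tangent (1 - alpha) k%:R x s01 kp x0.
  have t2 := powR_tangent (1 - alpha) x k%:R s01 x0 kp.
  have e1 : 1 - alpha - 1 = - alpha by lra.
  rewrite e1 in t1 t2; rewrite /dF; apply/andP; split.
    by apply: mulr_ge0; [lra|move: t1; lra].
  have t3 := powRN_sub_le alpha x k%:R a01 k1 kx.
  have -> : (2 - alpha) * (1 - alpha) * alpha / (2 * k%:R) * (x - k%:R) =
     (2 - alpha) / 2 * ((1 - alpha) * (alpha / k%:R * (x - k%:R))).
    by field; rewrite gt_eqF.
  apply: ler_wpM2l; first lra.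
  have h0 : 0 <= x - k%:R by rewrite subr_ge0.
  have h1 : x - k%:R <= 1 by lra.
  have ak : 0 <= alpha / k%:R by rewrite divr_ge0// ltW.
  have t4 : (k%:R `^ (- alpha) - x `^ (- alpha)) * (x - k%:R) <=
      alpha / k%:R * (x - k%:R).
    apply: (@le_trans _ _ (alpha / k%:R * (x - k%:R) * (x - k%:R))).
      by rewrite ler_wpM2r.
    by rewrite ler_piMr// mulr_ge0.
  have := ler_wpM2l (ltW (proj1 (andP s01))) t4.
  by move: t2; lra.
(* Subtracting C (x - k)^2 before applying the mean value theorem keeps the
   factor 1/2 of the integral of x - k. *)
have cF (C : R) : {within `[k%:R, k.+1%:R],
    continuous (fun x => F x - C * ((x - k%:R) * (x - k%:R)))}.
  apply: derivable_within_continuous => x; rewrite in_itv/= => /andP[kx _].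
  have x0 : 0 < x by exact: lt_le_trans kx.
  by have := derF x x0 => ?; exact: ex_derive.
have mvt (C : R) : exists2 x, k%:R < x < k.+1%:R &
    coef_c alpha k - C = dF x - 2 * C * (x - k%:R).
  have [||x] := @MVT _ (fun x => F x - C * ((x - k%:R) * (x - k%:R)))
    (fun x => dF x - 2 * C * (x - k%:R)) k%:R k.+1%:R _ _ (cF C).
  - by rewrite ltr_nat.
  - move=> x; rewrite in_itv/= => /andP[kx _].
    have x0 : 0 < x by exact: lt_trans kx.
    have := derF x x0 => ?; apply: is_derive_eq.
    by rewrite /GRing.scale/=; ring.
  rewrite in_itv/= => kxk E; exists x => //.
  by move: E; rewrite Fk FkS -natr1; lra.
apply/andP; split.
  have [x /andP[kx xk]] := mvt 0; rewrite !(mulr0, mul0r, subr0) => ->.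
  by have /andP[] := dF_le x (ltW kx) (ltW xk).
have [x /andP[kx xk]] := mvt ((2 - alpha) * (1 - alpha) * alpha / (4 * k%:R)).
have /andP[_] := dF_le x (ltW kx) (ltW xk).
have ki : 0 < k%:R^-1 :> R by rewrite invr_gt0.
have C4 : (2 - alpha) * (1 - alpha) * alpha / (4 * k%:R) <=
     alpha * (1 - alpha) / (2 * k%:R).
  have -> : (2 - alpha) * (1 - alpha) * alpha / (4 * k%:R) =
     alpha * (1 - alpha) / (2 * k%:R) * (1 - alpha / 2) by field; rewrite gt_eqF.
  rewrite ler_piMr//; last lra.
  by rewrite divr_ge0 ?mulr_ge0 ?(ltW a0) ?subr_ge0 ?(ltW a1).
have -> : (2 - alpha) * (1 - alpha) * alpha / (2 * k%:R) =
  2 * ((2 - alpha) * (1 - alpha) * alpha / (4 * k%:R)) by field; rewrite gt_eqF.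
by move: C4; set C := _ / (4 * k%:R); lra.
Qed.

End coefficients.

Section convolution_form.
Context {R : realType}.
Implicit Types alpha : R.

(** Second difference of t^(2-alpha) - (2-alpha)/2 t^(1-alpha), with the
    convention 0^s = 0 for s > 0 at m = 0. *)
Definition history_kernel alpha (m : nat) : R :=
  (m.+2%:R `^ (2 - alpha) - 2 * m.+1%:R `^ (2 - alpha) + m%:R `^ (2 - alpha))
  - (2 - alpha) / 2 *
    (m.+2%:R `^ (1 - alpha) - 2 * m.+1%:R `^ (1 - alpha) + m%:R `^ (1 - alpha)).

Lemma history_kernel0 alpha : 0 < alpha < 1 ->
  history_kernel alpha 0 = coef_c alpha 1 + 2 - 3 / 2 * alpha.
Proof.
move=> /andP[a0 a1]; rewrite /history_kernel /coef_c !powR1 !powR0 ?gt_eqF//; lra.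
Qed.

Lemma history_kernelS alpha m :
  history_kernel alpha m.+1 = coef_c alpha m.+2 - coef_a alpha m.+1.
Proof. by rewrite /history_kernel /coef_c /coef_a; lra. Qed.

Lemma history_kernel_pairing_ge0 alpha (q : {poly R}) : 0 < alpha < 1 ->
  unit_nonneg q -> 0 <= pairing (history_kernel alpha) q.
Proof.
move=> /andP[a0 a1] q0.
have P0 := power_pairing_diff2_ge0 (2 - alpha) q ltac:(apply/andP; split; lra) q0.
have p0 := power_pairing_diff2_le0 (1 - alpha) q ltac:(apply/andP; split; lra) q0.
have -> : pairing (history_kernel alpha) q =
    power_pairing (2 - alpha) 0 (('X - 1) * (('X - 1) * q)) -
    (2 - alpha) / 2 * power_pairing (1 - alpha) 0 (('X - 1) * (('X - 1) * q)).
  rewrite /power_pairing !pairing_mulXB1 /pairing mulr_sumr -sumrB.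
  by apply: eq_bigr => i _; rewrite /history_kernel !addr0; ring.
have : (2 - alpha) / 2 *
    power_pairing (1 - alpha) 0 (('X - 1) * (('X - 1) * q)) <= 0.
  by rewrite mulr_ge0_le0//; lra.
by lra.
Qed.

Lemma scaler3D (V : lmodType R) (a b c : R) (x y z : V) :
  a *: x + b *: (x + y) + c *: (x + y + z) =
  (a + b + c) *: x + (b + c) *: y + c *: z.
Proof.
by rewrite !scalerDr !scalerDl !addrA; do 2![congr (_ + _)]; rewrite addrAC.
Qed.

(** Since a_j + b_j + c_j = 0, each local quadratic contributes
    c_j D_(k-j+1) - a_j D_(k-j); shifting the index of the first part by one
    collects the coefficient c_(j+1) - a_j = kappa_j of D_(k-j), with the
    boundary terms c_k D_1 and c_1 D_k. *)
Lemma L2_operator_convolution (V : lmodType R) alpha (dt : R) (u : nat -> V) k :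
  0 < alpha < 1 -> 0 < dt ->
  Gamma (3 - alpha) = (2 - alpha) * Gamma (2 - alpha) ->
  (0 < k)%N ->
  let D := diff_quot dt u in
  L2_operator alpha dt u k = (dt `^ (1 - alpha) / Gamma (3 - alpha)) *:
    (alpha *: D k - (alpha / 2) *: D (k - 1)%N
     + \sum_(0 <= j < k) history_kernel alpha j *: D (k - j)%N
     - coef_c alpha k *: D 1%N
     - (if k == 1%N then alpha / 2 else 0) *: D 1%N).
Proof.
move=> a01 dt0 gammaS k0 D; have /andP[a0 a1] := a01.
have D0 : D 0%N = 0 by [].
have uS i : u i.+1 = u i + dt *: D i.+1.
  by rewrite /D/= scalerA mulfV ?gt_eqF// scale1r addrC subrK.
clearbody D.
have dtE (g : R) : (g * dt `^ alpha)^-1 * dt = dt `^ (1 - alpha) / g.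
  rewrite powRB ?(gt_eqF dt0) ?implybT// powRr1 ?(ltW dt0)// invfM; ring.
case: k k0 => // -[_|k _].
  have -> : L2_operator alpha dt u 1 =
      (Gamma (2 - alpha) * dt `^ alpha)^-1 *: (u 1%N - u 0%N) by [].
  rewrite uS [u 0%N + _]addrC addrK scalerA.
  rewrite big_nat1 subn0 subnn D0 scaler0 subr0 eqxx.
  rewrite -scalerDl -!scalerBl [RHS]scalerA history_kernel0//; congr (_ *: _).
  have -> : alpha + (coef_c alpha 1 + 2 - 3 / 2 * alpha) - coef_c alpha 1
    - alpha / 2 = 2 - alpha by lra.
  rewrite dtE gammaS.
  have g2 : 2 - alpha != 0 by rewrite gt_eqF//; lra.
  by rewrite invfM [_^-1 / _]mulrC mulrA mulfVK.
rewrite /L2_operator.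
have local_step a b c i : a + b + c = 0 ->
    a *: u i + b *: u i.+1 + c *: u i.+2 =
    dt *: (c *: D i.+2 - a *: D i.+1).
  move=> abc; rewrite !uS scaler3D abc scale0r add0r.
  have -> : b + c = - a by lra.
  by rewrite addrC scalerBr !scalerA mulNr scaleNr (mulrC a) (mulrC c).
have tail : (alpha / 2) *: u (k.+2 - 2)%N - 2 *: u (k.+2 - 1)%N +
    ((4 - alpha) / 2) *: u k.+2 =
    dt *: (((4 - alpha) / 2) *: D k.+2 - (alpha / 2) *: D k.+1).
  rewrite subn2 subn1/= -scaleNr; apply: local_step; lra.
have regroup (x y z t : V) : x + y - z + t = x + (y - z + t) by rewrite !addrA.
rewrite regroup tail.
have -> : \sum_(1 <= j < k.+2) (coef_a alpha j *: u (k.+2 - j - 1)%N +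
      coef_b alpha j *: u (k.+2 - j)%N + coef_c alpha j *: u (k.+2 - j + 1)%N) =
    dt *: \sum_(1 <= j < k.+2) (coef_c alpha j *: D (k.+2 - j + 1)%N -
      coef_a alpha j *: D (k.+2 - j)%N).
  rewrite scaler_sumr big_nat_cond [RHS]big_nat_cond.
  apply: eq_bigr => j /andP[/andP[j1 jk] _].
  have [i ->] : exists i, (k.+2 - j)%N = i.+1.
    by exists (k.+2 - j).-1; rewrite prednK// subn_gt0.
  rewrite subn1 addn1/= local_step//.
  by rewrite /coef_a /coef_b /coef_c; lra.
rewrite -scalerDr scalerA dtE; congr (_ *: _).
pose G j := coef_c alpha j *: D (k.+2 - j + 1)%N.
have shift : \sum_(1 <= j < k.+2) (coef_c alpha j.+1 *: D (k.+2 - j)%N) =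
    \sum_(1 <= j < k.+2) G j + coef_c alpha k.+2 *: D 1%N
    - coef_c alpha 1 *: D k.+2.
  have GE j : (1 <= j < k.+2)%N -> coef_c alpha j.+1 *: D (k.+2 - j)%N = G j.+1.
    by move=> /andP[_ jk]; rewrite /G addn1 subnSK.
  have := @telescope_sumr V 1 k.+2 G isT; rewrite sumrB.
  have -> : G k.+2 = coef_c alpha k.+2 *: D 1%N by rewrite /G subnn.
  have -> : G 1%N = coef_c alpha 1 *: D k.+2 by rewrite /G subn1 addn1.
  move=> telescope.
  rewrite -addrA -telescope addrC subrK.
  by rewrite big_nat_cond [RHS]big_nat_cond; apply: eq_bigr => j /andP[/GE].
have convE : \sum_(0 <= j < k.+2) history_kernel alpha j *: D (k.+2 - j)%N =
    history_kernel alpha 0 *: D k.+2 +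
    (\sum_(1 <= j < k.+2) coef_c alpha j.+1 *: D (k.+2 - j)%N -
     \sum_(1 <= j < k.+2) coef_a alpha j *: D (k.+2 - j)%N).
  rewrite big_ltn// subn0 -sumrB; congr (_ + _).
  rewrite big_nat_cond [RHS]big_nat_cond.
  by apply: eq_bigr => -[|j] //= _; rewrite history_kernelS scalerBl.
rewrite convE shift sumrB scale0r subr0 subn1/= history_kernel0//.
set A := \sum_(1 <= j < k.+2) coef_a alpha j *: _.
set C := \sum_(1 <= j < k.+2) G j.
have -> : (4 - alpha) / 2 =
    alpha + (coef_c alpha 1 + 2 - 3 / 2 * alpha) - coef_c alpha 1 by lra.
rewrite scalerBl [(alpha + _) *: _]scalerDl.
set X := alpha *: _; set Y := (alpha / 2) *: _; set Z := (_ + 2 - _) *: _.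
set W := coef_c alpha k.+2 *: _; set T := coef_c alpha 1 *: _.
rewrite [C + W]addrC -[W + C - T]addrA -[W + (C - T) - A]addrA.
rewrite [Z + _]addrCA [X - Y + (W + _)]addrCA [W + _ - W]addrAC subrr add0r.
by rewrite [LHS](AC (2*4) ((3*6)*(4*((1*5)*2)))).
Qed.

End convolution_form.

(** * Energy estimate for a semidefinite bilinear form *)

Lemma eq_ge0 (R : realType) (x y : R) : x = y -> 0 <= x -> 0 <= y.
Proof. by move=> ->. Qed.

Section semi_inner_product.
Context {R : realType} {V : lmodType R} (dot : V -> V -> R).
Hypothesis dotDZl : forall a x y z, dot (a *: x + y) z = a * dot x z + dot y z.
Hypothesis dotC : forall x y, dot x y = dot y x.
Hypothesis dot_ge0 : forall x, 0 <= dot x x.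

Lemma dot0l z : dot 0 z = 0.
Proof. by have := dotDZl (-1) 0 0 z; rewrite scaler0 addr0; lra. Qed.

Lemma dotDl x y z : dot (x + y) z = dot x z + dot y z.
Proof. by rewrite -[x]scale1r dotDZl !scale1r mul1r. Qed.

Lemma dotZl a x z : dot (a *: x) z = a * dot x z.
Proof. by rewrite -[a *: x]addr0 dotDZl dot0l addr0. Qed.

Lemma dotNl x z : dot (- x) z = - dot x z.
Proof. by rewrite -scaleN1r dotZl mulN1r. Qed.

Lemma dotDr x y z : dot z (x + y) = dot z x + dot z y.
Proof. by rewrite dotC dotDl !(dotC _ z). Qed.

Lemma dotZr a x z : dot z (a *: x) = a * dot z x.
Proof. by rewrite dotC dotZl dotC. Qed.

Lemma dotNr x z : dot z (- x) = - dot z x.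
Proof. by rewrite dotC dotNl dotC. Qed.

Lemma dot_suml I (r : seq I) (P : pred I) (F : I -> V) z :
  dot (\sum_(i <- r | P i) F i) z = \sum_(i <- r | P i) dot (F i) z.
Proof.
by apply: (big_morph (dot^~ z)) => [x y|]; [exact: dotDl|exact: dot0l].
Qed.

Let dotE := (dotDl, dotDr, dotZl, dotZr, dotNl, dotNr).

(** With E = |a|^2/2 + (r/2)|2a - b|^2, the left side minus the energy increment
    is affine in r: at r = 1 it is |a - 2b + c|^2 / 2, the G-stability identity of
    BDF2, and at r = 0 it is 2|a|^2 + |a - b|^2 / 2. *)
Lemma bdf2_energy_step r a b c : 0 <= r <= 1 ->
  dot a (3 *: (a - r *: b) - (b - r *: c)) >=
  (2^-1 * dot a a + r / 2 * dot (2 *: a - b) (2 *: a - b)) -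
  (2^-1 * dot b b + r / 2 * dot (2 *: b - c) (2 *: b - c)).
Proof.
move=> /andP[r0 r1].
have h1 := dot_ge0 (a - 2 *: b + c); have h2 := dot_ge0 (a - b).
have h3 := dot_ge0 a.
have : 0 <= (1 - r) * (2^-1 * dot (a - b) (a - b) + 2 * dot a a) +
   r / 2 * dot (a - 2 *: b + c) (a - 2 *: b + c).
  by rewrite addr_ge0// mulr_ge0 ?subr_ge0 ?addr_ge0 ?mulr_ge0 ?divr_ge0.
rewrite -[X in _ -> is_true X]subr_ge0; apply: eq_ge0.
rewrite !dotE (dotC b a) (dotC c a) (dotC c b).
by field.
Qed.

(** The first step, where v_0 = 0, produces 3|v_1|^2, more than its energy
    increment by at least |v_1|^2 / 2. *)
Lemma geometric_energy_ge0 r (v : nat -> V) n : 0 <= r <= 1 -> v 0%N = 0 ->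
  (0 < n)%N ->
  2^-1 * dot (v 1%N) (v 1%N) <=
  \sum_(1 <= k < n.+1)
    dot (v k) (3 *: (v k - r *: v (k - 1)%N) -
               (v (k - 1)%N - r *: v (k - 2)%N)).
Proof.
move=> r01 v0 n0.
suff: 2^-1 * dot (v 1%N) (v 1%N) + (2^-1 * dot (v n) (v n) +
   r / 2 * dot (2 *: v n - v (n - 1)%N) (2 *: v n - v (n - 1)%N)) <=
  \sum_(1 <= k < n.+1)
    dot (v k) (3 *: (v k - r *: v (k - 1)%N) -
               (v (k - 1)%N - r *: v (k - 2)%N)).
  apply: le_trans; rewrite lerDl addr_ge0 ?mulr_ge0 ?divr_ge0//.
  by case/andP: r01.
case: n n0 => // n _; elim: n => [|n IH].
  rewrite big_nat1 subnn v0 !(scaler0, subr0) !dotE.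
  have := dot_ge0 (v 1%N); case/andP: r01 => r0 r1 h.
  by rewrite ?dot0l; nra.
rewrite big_nat_recr//=.
have := bdf2_energy_step _ (v n.+2) (v n.+1) (v n) r01.
rewrite subn1/= in IH *; rewrite subn2 /=.
by move: IH; lra.
Qed.

(** After scaling, the difference of the two sides is a positive semidefinite
    quadratic form in a, b and z = (2c/e) x. *)
Lemma history_term_step e c a b x : 0 < e ->
  e / 2 * (2 * dot a a - dot b b) - 2 * c ^+ 2 / e * dot x x <=
  e * dot a (3 *: a - b) - e / 2 * dot b (3 *: a - b) - c * dot x (3 *: a - b).
Proof.
move=> e0; have := ltW e0 => e0'.
set z := (2 * c / e) *: x.
(* Completing the square in 4a^2 - 5ab + 2b^2 - 3az + bz + z^2. *)
have : 0 <= e / 2 * (dot (2 *: a - (5 / 4) *: b - (3 / 4) *: z)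
                     (2 *: a - (5 / 4) *: b - (3 / 4) *: z)
     + 7 / 16 * dot (b - z) (b - z)).
  by rewrite mulr_ge0 ?divr_ge0 ?addr_ge0 ?mulr_ge0.
rewrite -[X in _ -> is_true X]subr_ge0; apply: eq_ge0; rewrite /z !dotE.
rewrite (dotC b a) (dotC x a) (dotC x b).
by field; rewrite gt_eqF.
Qed.

(** Because D_0 = 0 and subtraction is truncated, the inner sum may run over all
    j < n, which makes the two summations independent. *)
Lemma convolution_swap (D E : nat -> V) (g : nat -> R) n : D 0%N = 0 ->
  \sum_(1 <= k < n.+1) dot (\sum_(0 <= j < k) g j *: D (k - j)%N) (E k) =
  \sum_(0 <= j < n) (\sum_(1 <= k < n.+1) dot (D (k - j)%N) (E k)) * g j.
Proof.
move=> D0; under [RHS]eq_bigr do rewrite mulr_suml.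
rewrite exchange_big/= big_nat_cond [RHS]big_nat_cond.
apply: eq_bigr => k /andP[/andP[k1 kn] _].
rewrite dot_suml [RHS](big_cat_nat (leq0n k))//=.
rewrite [X in _ = _ + X]big1_seq ?addr0; last first.
  move=> j; rewrite mem_index_iota => /andP[_ /andP[kj _]].
  by have /eqP -> := kj; rewrite D0 dot0l mul0r.
by apply: eq_bigr => j _; rewrite dotZl mulrC.
Qed.

Lemma geometric_convolution_ge0 (D : nat -> V) r n : 0 <= r <= 1 ->
  D 0%N = 0 -> (0 < n)%N ->
  2^-1 * dot (D 1%N) (D 1%N) <=
  \sum_(1 <= k < n.+1) dot (\sum_(0 <= j < k) r ^+ j *: D (k - j)%N)
                           (3 *: D k - D (k - 1)%N).
Proof.
move=> r01 D0 n0; pose v k := \sum_(0 <= j < k) r ^+ j *: D (k - j)%N.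
have v0 : v 0%N = 0 by rewrite /v big_geq.
have vS k : v k.+1 = D k.+1 + r *: v k.
  rewrite /v big_nat_recl// expr0 scale1r subn0; congr (_ + _).
  rewrite scaler_sumr; apply: eq_bigr => j _.
  by rewrite scalerA -exprS subSS.
have := geometric_energy_ge0 r v n r01 v0 n0.
rewrite vS v0 scaler0 addr0 => /le_trans; apply.
rewrite le_eqVlt; apply/predU1P; left.
rewrite big_nat_cond [RHS]big_nat_cond; apply: eq_bigr => k /andP[/andP[k1 kn] _].
case: k k1 kn => // k _ _; rewrite subSS subn0 vS addrK; congr (dot _ (_ - _)).
  by rewrite -vS.
case: k => [|k]; first by rewrite v0 D0 scaler0 subr0.
by rewrite vS !subSS subn0 addrK.
Qed.

(** The difference of the two sides is the pairing of kappa with a polynomial whose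
    values on [0, 1] are the geometric case, so positivity of the functional
    transfers the geometric bound to kappa. *)
Lemma moment_convolution_ge0 (D : nat -> V) (kappa : nat -> R) n :
  (forall q : {poly R}, unit_nonneg q -> 0 <= pairing kappa q) ->
  D 0%N = 0 -> (0 < n)%N ->
  2^-1 * kappa 0%N * dot (D 1%N) (D 1%N) <=
  \sum_(1 <= k < n.+1) dot (\sum_(0 <= j < k) kappa j *: D (k - j)%N)
                           (3 *: D k - D (k - 1)%N).
Proof.
move=> kappa_pos D0 n0.
pose E k := 3 *: D k - D (k - 1)%N.
(* The lower bound is carried by the constant coefficient of the polynomial. *)
pose h j : R := if j is 0%N then 2^-1 * dot (D 1%N) (D 1%N) else 0.
pose q j := \sum_(1 <= k < n.+1) dot (D (k - j)%N) (E k).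
have hE (g : nat -> R) : \sum_(j < n) (q j - h j) * g j =
    \sum_(1 <= k < n.+1) dot (\sum_(0 <= j < k) g j *: D (k - j)%N) (E k) -
    2^-1 * dot (D 1%N) (D 1%N) * g 0%N.
  rewrite convolution_swap// big_mkord; under eq_bigr do rewrite mulrBl.
  rewrite sumrB; congr (_ - _).
  case: n n0 {q} => // m _; rewrite big_ord_recl/= big1 ?addr0// => i _.
  by rewrite mul0r.
have /kappa_pos : unit_nonneg (\poly_(j < n) (q j - h j)).
  move=> r r01; rewrite horner_poly hE expr0 mulr1 subr_ge0.
  exact: geometric_convolution_ge0.
by rewrite pairing_poly hE subr_ge0 mulrAC.
Qed.

(** The memory term gives kappa_0/2 = 1 - 3 alpha/4 + c_1/2 times |D_1|^2.  The
    terms with k >= 2 give alpha/2 sum_(k>=2) |D_k|^2, at the cost of alpha/2 and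
    of alpha (1-alpha)^2 / 2 times |D_1|^2, the latter from the squares of c_k.
    With the 3 alpha/2 - 3 c_1 of k = 1, and after subtracting the alpha/2 of the
    conclusion, the bound on c_1 leaves a coefficient of |D_1|^2 that is at least
    1 - alpha/4 - 5 alpha (1-alpha)/4 - alpha (1-alpha)^2 / 2 >= 0. *)
Lemma l2_energy (D : nat -> V) (kappa c : nat -> R) (alpha : R) n :
  0 < alpha < 1 ->
  (forall q : {poly R}, unit_nonneg q -> 0 <= pairing kappa q) ->
  kappa 0%N = c 1%N + 2 - 3 / 2 * alpha ->
  (forall k, (0 < k)%N -> 0 <= c k <= alpha * (1 - alpha) / (2 * k%:R)) ->
  D 0%N = 0 -> (0 < n)%N ->
  alpha / 2 * (\sum_(1 <= k < n.+1) dot (D k) (D k)) <=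
  \sum_(1 <= k < n.+1)
    dot (alpha *: D k - (alpha / 2) *: D (k - 1)%N
         + \sum_(0 <= j < k) kappa j *: D (k - j)%N - c k *: D 1%N
         - (if k == 1%N then alpha / 2 else 0) *: D 1%N)
        (3 *: D k - D (k - 1)%N).
Proof.
move=> /andP[a0 a1] kappa_pos kappa0 c_bound D0 n0.
pose t k := alpha * dot (D k) (3 *: D k - D (k - 1)%N)
  - alpha / 2 * dot (D (k - 1)%N) (3 *: D k - D (k - 1)%N)
  - c k * dot (D 1%N) (3 *: D k - D (k - 1)%N).
(* The factor 1 - 1/(m+1) telescopes the bound 1/k^2 <= 1/(k-1) - 1/k. *)
have history m : alpha / 2 * (\sum_(2 <= k < m.+2) dot (D k) (D k)
      + dot (D m.+1) (D m.+1) - dot (D 1%N) (D 1%N))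
    - alpha * (1 - alpha) ^+ 2 / 2 * (1 - m.+1%:R^-1) * dot (D 1%N) (D 1%N)
    <= \sum_(2 <= k < m.+2) t k.
  elim: m => [|m IH]; first by rewrite !big_geq// invr1; lra.
  have recr (f : nat -> R) :
      \sum_(2 <= k < m.+3) f k = \sum_(2 <= k < m.+2) f k + f m.+2.
    by rewrite big_nat_recr.
  rewrite !recr.
  have := history_term_step alpha (c m.+2) (D m.+2) (D m.+1) (D 1%N) a0.
  have : t m.+2 = alpha * dot (D m.+2) (3 *: D m.+2 - D m.+1)
     - alpha / 2 * dot (D m.+1) (3 *: D m.+2 - D m.+1)
     - c m.+2 * dot (D 1%N) (3 *: D m.+2 - D m.+1) by rewrite /t subn1.
  move=> tE step.
  suff: 2 * c m.+2 ^+ 2 / alpha * dot (D 1%N) (D 1%N) <=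
     alpha * (1 - alpha) ^+ 2 / 2 * (m.+1%:R^-1 - m.+2%:R^-1) *
     dot (D 1%N) (D 1%N).
    move: IH step; rewrite -tE.
    set S1 := \sum_(2 <= k < m.+2) _; set S2 := \sum_(2 <= k < m.+2) _.
    move: (t _) (dot (D m.+2) _) (dot (D m.+1) _) (dot _ (D 1%N)) S1 S2.
    move: (m.+1%:R^-1) (m.+2%:R^-1) (alpha * (1 - alpha) ^+ 2) => *.
    lra.
  rewrite ler_wpM2r//.
  have /andP[c0 c1] := c_bound m.+2 isT.
  have : c m.+2 ^+ 2 <= (alpha * (1 - alpha) / (2 * m.+2%:R)) ^+ 2.
    by rewrite ler_sqr// nnegrE// (le_trans c0).
  have m1 : 0 < m.+1%:R :> R by [].
  have m2 : m.+2%:R = m.+1%:R + 1 :> R by rewrite -natr1.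
  rewrite m2; set x := m.+1%:R in m1 *; move=> h.
  have -> : alpha * (1 - alpha) ^+ 2 / 2 * (x^-1 - (x + 1)^-1) =
      alpha * (1 - alpha) ^+ 2 / (2 * (x * (x + 1))) by field; lra.
  apply: (@le_trans _ _ (2 * (alpha * (1 - alpha) / (2 * (x + 1))) ^+ 2 / alpha)).
    by rewrite ler_wpM2r ?invr_ge0 ?(ltW a0)// ler_wpM2l.
  have -> : 2 * (alpha * (1 - alpha) / (2 * (x + 1))) ^+ 2 / alpha =
      alpha * (1 - alpha) ^+ 2 / (2 * ((x + 1) * (x + 1))) by field; lra.
  apply: ler_wpM2l; first by rewrite mulr_ge0 ?sqr_ge0 ?(ltW a0).
  have xx : 0 < x * x by rewrite mulr_gt0.
  by rewrite lef_pV2 ?posrE; lra.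
have {history} := history n.-1; rewrite prednK// => history.
have := moment_convolution_ge0 D kappa n kappa_pos D0 n0.
rewrite [X in _ -> _ <= X](eq_bigr (fun k => t k +
  dot (\sum_(0 <= j < k) kappa j *: D (k - j)%N) (3 *: D k - D (k - 1)%N) -
  (if k == 1%N then alpha / 2 else 0) * dot (D 1%N) (3 *: D k - D (k - 1)%N)));
  last by move=> k _; rewrite /t !(dotDl, dotNl, dotZl); ring.
rewrite sumrB big_split/=.
set K := \sum_(1 <= k < n.+1) dot (\sum_(0 <= j < k) _) _ => K_ge.
rewrite [\sum_(1 <= k < n.+1) t k]big_ltn//.
rewrite [\sum_(1 <= k < n.+1) dot _ _]big_ltn//.
rewrite [X in _ - X]big_ltn// [X in _ - (_ + X)]big1_seq ?addr0/=; last first.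
  move=> k; rewrite mem_index_iota => /andP[k2 _].
  by rewrite ifF ?mul0r//; apply/eqP => k1; rewrite k1 in k2.
have t1 : t 1%N = (3 * alpha - 3 * c 1%N) * dot (D 1%N) (D 1%N).
  by rewrite /t subnn D0 subr0 dot0l dotZr; ring.
rewrite t1 subnn D0 subr0 dotZr.
move: (dot_ge0 (D 1%N)) (dot_ge0 (D n)) K_ge history; rewrite kappa0.
have /andP[c0 c1] := c_bound 1%N isT.
have n1 : 0 < n%:R^-1 :> R by rewrite invr_gt0 ltr0n.
move: c0 c1; rewrite mulr1.
set d1 := dot (D 1%N) _; set dn := dot (D n) _ => c0 c1 d10 dn0 K_ge history.
have hn : 0 <= alpha * (1 - alpha) ^+ 2 / 2 * n%:R^-1 * d1.
  rewrite mulr_ge0// mulr_ge0 ?(ltW n1)// divr_ge0// mulr_ge0 ?sqr_ge0//.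
  exact: ltW.
have hdn : 0 <= alpha / 2 * dn by rewrite mulr_ge0// divr_ge0// ltW.
have hd1 : 0 <= (1 - alpha / 4 - 5 / 2 * (alpha * (1 - alpha) / 2)
   - alpha * (1 - alpha) ^+ 2 / 2) * d1 by rewrite mulr_ge0//; nra.
have hc1 : c 1%N * d1 <= alpha * (1 - alpha) / 2 * d1 by rewrite ler_wpM2r.
lra.
Qed.

End semi_inner_product.

(** * The inner product of square-integrable functions *)

Section L2_inner_product.
Context {R : realType} {d : nat} {Omega : bounded_domain R d}.
Implicit Types f g h : L2 Omega.

(** Hoelder's inequality makes the inner product finite, so that it is additive. *)
Lemma integrable_L2fun_mul f g :
  (domain_measure Omega).-integrable setT (EFin \o (L2fun f \* L2fun g)).
Proof. by apply/Lfun1_integrable; apply: Lfun2_mul_Lfun1; exact: LfunP. Qed.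

Lemma L2dotDZl a f g h : L2dot (a *: f + g) h = a * L2dot f h + L2dot g h.
Proof.
rewrite /L2dot -RintegralZl//; last exact: integrable_L2fun_mul.
rewrite -RintegralD//; last 2 first.
- have := integrableZl measurableT a (integrable_L2fun_mul f h).
  by apply: eq_integrable => // x _ /=; rewrite EFinM.
- exact: integrable_L2fun_mul.
apply: eq_Rintegral => x _.
rewrite (_ : L2fun (a *: f + g) x = a * L2fun f x + L2fun g x)//.
by rewrite mulrDl mulrA.
Qed.

Lemma L2dotC f g : L2dot f g = L2dot g f.
Proof. by apply: eq_Rintegral => x _; rewrite mulrC. Qed.

Lemma L2dot_ge0 f : 0 <= L2dot f f.
Proof. by apply: Rintegral_ge0 => x _; rewrite -expr2 sqr_ge0. Qed.

Lemma L2norm_sqr f : L2norm f ^+ 2 = L2dot f f.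
Proof.
have Nfin := finite_norm_fine f.
rewrite -powR_mulrn ?fine_ge0 ?Lnorm_ge0// -[LHS]/(fine (_ `^ 2)%:E) -poweR_EFin.
rewrite Nfin poweR_Lnorm// /L2dot /Rintegral; congr fine.
apply: eq_integral => x _ /=.
by rewrite -[2]/(2%:R) powR_mulrn// -normrX ger0_norm ?sqr_ge0// expr2.
Qed.

End L2_inner_product.

Theorem lemma2p2 (R : realType) (d : nat) (hd : (1 <= d)%N)
    (Omega : bounded_domain R d) (alpha T : R) (halpha : 0 < alpha < 1)
    (hT : 0 < T) (N : nat) (hN : (1 <= N)%N)
    (u : R -> L2 Omega) (hu : L2_continuous T u)
    (n : nat) (hn : (1 <= n <= N)%N) :
  let dt := T / N%:R in
  let U := fun k : nat => u (k%:R * dt) in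
  let D := diff_quot dt U in
  let L := L2_operator alpha dt U in
  let bound := alpha * dt `^ (1 - alpha) / (2 * Gamma (3 - alpha)) *
    \sum_(1 <= k < n.+1) L2norm (D k) ^+ 2 in
  \sum_(1 <= k < n.+1) L2dot (L k) (3 *: D k - D (k - 1)%N) >= bound
  /\ bound >= 0.
Proof.
move=> dt U D L bound; have /andP[a0 a1] := halpha.
have dt0 : 0 < dt by rewrite divr_gt0// ltr0n.
have GS : Gamma (3 - alpha) = (2 - alpha) * Gamma (2 - alpha).
  rewrite -GammaS; last by apply/andP; split; lra.
  by congr Gamma; lra.
pose w := dt `^ (1 - alpha) / Gamma (3 - alpha).
have w0 : 0 <= w by rewrite divr_ge0 ?powR_ge0 ?Gamma_ge0.
have boundE : bound = w * (alpha / 2 * \sum_(1 <= k < n.+1) L2dot (D k) (D k)).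
  rewrite /bound /w invfM; under eq_bigr do rewrite L2norm_sqr.
  by ring.
split; last first.
  rewrite boundE mulr_ge0// mulr_ge0 ?divr_ge0 ?(ltW a0)//.
  by rewrite sumr_ge0// => k _; exact: L2dot_ge0.
case/andP: hn => n0 _.
have energy := @l2_energy _ _ _ L2dotDZl L2dotC L2dot_ge0 D
  (history_kernel alpha) (coef_c alpha) alpha n halpha
  (fun q => history_kernel_pairing_ge0 alpha q halpha)
  (history_kernel0 alpha halpha)
  (fun k => coef_c_bound alpha k halpha) erefl n0.
rewrite boundE; apply: le_trans (ler_wpM2l w0 energy) _.
rewrite mulr_sumr le_eqVlt; apply/predU1P; left.
rewrite big_nat_cond [RHS]big_nat_cond.
apply: eq_bigr => k /andP[/andP[k0 _] _].
rewrite /L L2_operator_convolution//.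
by rewrite -(@dotZl _ _ _ L2dotDZl).
Qed.
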